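(* Let $A$ be a set with at least three elements and $I$ a finite set. Let $C\colon\mathrm{PPO}_A^I\to\mathrm{PPO}_A$ be a voting system satisfying unanimity and independence of irrelevant alternatives. Then there exists a map $\delta\colon 2^I\to 2^I$ such that, for every $N\subseteq I$, $\delta N$ is the minimal (with respect to inclusion) subset of $I\setminus N$ that is decisive relative to $N$. Moreover, $\Delta\colon 2^I\to 2^I$, $\Delta N=\delta N\sqcup N$, is the unique map with the following properties: (1) (Monotonicity) $N\subseteq\Delta N$ and $\Delta M\subseteq\Delta N$ for all $M\subseteq N\subseteq I$; (2) (Minimality) if $\Delta N\cap M=\emptyset$ for some $N,M\subseteq I$, then $\Delta(N\sqcup M)=\Delta N\sqcup M$; (3) (Decisiveness) for every profile and all $a,b\in A$: $a\succsim b$ if and only if there exists $N\subseteq I$ with $a\sim_N b$ and $a\succ_{\Delta N\setminus N} b$. Conversely, given an arbitrary map $\Delta\colon 2^I\to 2^I$ satisfying (1), set $\delta N=\Delta N\setminus N$ and define $C_\Delta\colon\mathrm{PPO}_A^I\to\mathrm{PPO}_A$ by the rule (3). Then $C_\Delta$ is a well-defined voting system satisfying unanimity, neutrality, monotonicity and independence of irrelevant alternatives; and if $\Delta$ also satisfies (2), then for each $N\subseteq I$ the set $\delta N$ is the minimal decisive set relative to $N$ for $C_\Delta$.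
   Context: An ordering on $A$ is a reflexive and transitive relation $P\subseteq A\times A$; $\mathrm{PPO}_A$ is the set of all of them. A voting system is a map $C\colon\mathrm{PPO}_A^I\to\mathrm{PPO}_A$ on profiles $P=(P_i)_{i\in I}$. For a profile $P$: $a\succsim b$ means $(a,b)\in C(P)$, $a\succsim_i b$ means $(a,b)\in P_i$; $a\succ b$ means $a\succsim b$ and not $b\succsim a$; $a\sim b$ means $a\succsim b$ and $b\succsim a$; same with subscripts. For $J\subseteq I$, $a\succsim_J b$ means $a\succsim_j b$ for all $j\in J$, similarly $\succ_J$, $\sim_J$ (vacuously true for $J=\emptyset$). Unanimity: $a\succsim_I b$ implies $a\succsim b$. IIA: for profiles $P,P'$ with outcomes $\succsim,\succsim'$, if $\{i:a\succsim_i b\}=\{i:a\succsim'_i b\}$ and $\{i:b\succsim_i a\}=\{i:b\succsim'_i a\}$ then $a\succsim b\iff a\succsim' b$. Monotonicity: if $\{i:a\succsim_i b\}\subseteq\{i:a\succsim'_i b\}$ and $\{i:b\succsim_i a\}\supseteq\{i:b\succsim'_i a\}$ then $a\succsim b\Rightarrow a\succsim' b$. Neutrality: $C(\rho^*P_i)_i=\rho^*C(P)$ for every permutation $\rho$ of $A$, where $(a,b)\in\rho^*Q\iff(\rho a,\rho b)\in Q$. For $N\subseteq I$, a set $J\subseteq I\setminus N$ is decisive relative to $N$ if for every profile and all $a,b\in A$, $a\sim_N b$ and $a\succ_J b$ together imply $a\succsim b$. $X\sqcup Y$ denotes the union of disjoint sets. *)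

(* Defs.v *)
From Corelib Require Import RelationClasses.
From mathcomp Require Import all_boot.

Set Implicit Arguments.
Unset Strict Implicit.
Unset Printing Implicit Defensive.

(* Partial (possibly incomplete) preorders on an arbitrary type, valued in Prop
   so that A need not be finite or have decidable equality. *)
Record PPO (A : Type) := MkPPO {
  weak :> A -> A -> Prop;
  weak_preorder : PreOrder weak
}.

Definition strict (A : Type) (Q : PPO A) (a b : A) : Prop := Q a b /\ ~ Q b a.
Definition indiff (A : Type) (Q : PPO A) (a b : A) : Prop := Q a b /\ Q b a.

Lemma pullback_preorder (A : Type) (rho : A -> A) (Q : PPO A) :
  PreOrder (fun a b => Q (rho a) (rho b)).
Proof.
case: (weak_preorder Q) => Qrefl Qtrans; split.
- by move=> a; apply: Qrefl.
- by move=> a b c; apply: Qtrans.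
Qed.

Definition pullback (A : Type) (rho : A -> A) (Q : PPO A) : PPO A :=
  MkPPO (pullback_preorder rho Q).

Definition profile (A : Type) (I : finType) := I -> PPO A.
Definition voting_system (A : Type) (I : finType) := profile A I -> PPO A.

Section Defs.
Variables (A : Type) (I : finType).
Implicit Types (P : profile A I) (C : voting_system A I) (J M N : {set I}).
Implicit Types (D : {set I} -> {set I}) (a b : A).

Definition weak_on P J a b : Prop := forall j, j \in J -> P j a b.
Definition strict_on P J a b : Prop := forall j, j \in J -> strict (P j) a b.
Definition indiff_on P J a b : Prop := forall j, j \in J -> indiff (P j) a b.

Definition unanimity C : Prop :=
  forall P a b, weak_on P [set: I] a b -> C P a b.

Definition IIA C : Prop := forall P P' a b,
  (forall i, P i a b <-> P' i a b) ->
  (forall i, P i b a <-> P' i b a) ->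
  (C P a b <-> C P' a b).

Definition vs_monotone C : Prop := forall P P' a b,
  (forall i, P i a b -> P' i a b) ->
  (forall i, P' i b a -> P i b a) ->
  C P a b -> C P' a b.

Definition neutrality C : Prop := forall (rho : A -> A), bijective rho ->
  forall P, C (fun i => pullback rho (P i)) = pullback rho (C P).

Definition decisive C N J : Prop :=
  J \subset ~: N /\
  forall P a b, indiff_on P N a b -> strict_on P J a b -> C P a b.

(* "The" minimal decisive set is the least one.  Any subset of ~: N containing
   a decisive set is decisive and I is finite, so a least decisive set is the
   same thing as a unique inclusion-minimal one. *)
Definition minimal_decisive C N J : Prop :=
  decisive C N J /\ forall K, decisive C N K -> J \subset K.

Definition map_monotone D : Prop :=
  (forall N, N \subset D N) /\ (forall M N, M \subset N -> D M \subset D N).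

(* Under map_monotone, the hypothesis makes both unions disjoint. *)
Definition map_minimality D : Prop :=
  forall N M, D N :&: M = set0 -> D (N :|: M) = D N :|: M.

Definition map_decisive C D : Prop := forall P a b,
  C P a b <-> exists N, indiff_on P N a b /\ strict_on P (D N :\: N) a b.

End Defs.

(* Main.v *)
(* The outcome on a pair depends only on the pattern of individual weak
   preferences on that pair, not on the pair itself, and monotonically so: a
   third alternative placed unanimously next to one of the two transfers the
   outcome by transitivity of C P.  Hence J is decisive relative to N as soon as
   the single worst pattern (indifference on N, strict preference on J, strict
   opposition elsewhere) yields a positive outcome.  Chaining two such patterns
   through a third alternative shows that decisive sets relative to N are closed
   under intersection, which gives a least one.
   For the converse, if N witnesses (a, b) and M witnesses (b, c), then the
   intersection of N and M witnesses (a, c), by monotonicity of Delta; and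
   minimality is read off the worst pattern above. *)
From Corelib Require Import RelationClasses.
Require Import Defs.
From mathcomp Require Import all_boot boolp.

Set Implicit Arguments.
Unset Strict Implicit.
Unset Printing Implicit Defensive.

Lemma PPO_ext (A : Type) (Q R : PPO A) : (forall a b, Q a b <-> R a b) -> Q = R.
Proof.
case: Q R => q hq [r hr] /= h.
have e : q = r by apply/funext => a; apply/funext => b; apply/propext.
by case: _ / e hr {h} => hr; congr MkPPO; apply: Prop_irrelevance.
Qed.

(** * Profiles prescribed on three alternatives *)

Variant three := First | Second | Third.

Section ThreePoints.
Variables (A : Type) (I : finType) (a b c : A).
Hypotheses (nab : a <> b) (nac : a <> c) (nbc : b <> c).
Variables ab ba ac ca bc cb : I -> Prop.
Hypothesis trans3 : forall i,
  ((ab i -> bc i -> ac i) /\ (ac i -> cb i -> ab i)) /\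
  ((ba i -> ac i -> bc i) /\ (bc i -> ca i -> ba i)) /\
  ((ca i -> ab i -> cb i) /\ (cb i -> ba i -> ca i)).

Let rel3 i (x y : three) : Prop :=
  match x, y with
  | First, Second => ab i | Second, First => ba i
  | First, Third => ac i | Third, First => ca i
  | Second, Third => bc i | Third, Second => cb i
  | _, _ => True
  end.

(** Every alternative other than [a] and [b] shares the place of [c], so pulling [rel3] back along
    [place] gives a preorder on all of [A]. *)
Let place (x : A) : three :=
  if pselect (x = a) then First else if pselect (x = b) then Second else Third.

Let profile3_preorder i : PreOrder (fun x y => rel3 i (place x) (place y)).
Proof.
split=> [x | x y z]; first by case: (place x).
by have := trans3 i; case: (place x) (place y) (place z) => [] [] [] /=; tauto.
Qed.

Lemma three_point_profile : exists P : profile A I, forall i,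
  (P i a b = ab i /\ P i b a = ba i) /\ (P i a c = ac i /\ P i c a = ca i) /\
  (P i b c = bc i /\ P i c b = cb i).
Proof.
exists (fun i => MkPPO (profile3_preorder i)) => i /=.
have -> : place a = First by rewrite /place; case: pselect.
have -> : place b = Second.
  by rewrite /place; case: (pselect (b = a)) => [/esym//|]; case: pselect.
have -> : place c = Third.
  rewrite /place; case: (pselect (c = a)) => [/esym//|].
  by case: (pselect (c = b)) => [/esym//|].
by [].
Qed.

End ThreePoints.

Section Outcome.
Variables (A : Type) (I : finType).
Hypothesis hA : exists a b c : A, a <> b /\ a <> c /\ b <> c.
Implicit Types (C : voting_system A I) (P Q : profile A I) (N M J K : {set I}).

Lemma third_alternative (a b : A) : exists c, a <> c /\ b <> c.
Proof.
have [x [y [z [xy [xz yz]]]]] := hA.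
have [xa|xa] := pselect (a = x); have [xb|xb] := pselect (b = x);
  have [ya|ya] := pselect (a = y); have [yb|yb] := pselect (b = y);
  subst; try by [exists x | exists y | exists z | congruence].
Qed.

Lemma two_point_profile (a b : A) (ab ba : I -> Prop) : a <> b ->
  exists P : profile A I, forall i, P i a b = ab i /\ P i b a = ba i.
Proof.
move=> nab; have [c [nac nbc]] := third_alternative a b.
(* Each voter ties [c] with [b], so all six transitivity conditions hold. *)
have [|P hP] := @three_point_profile A I a b c nab nac nbc ab ba ab ba
  (fun=> True) (fun=> True); first by move=> i; tauto.
by exists P => i; case: (hP i).
Qed.

Lemma outcome_refl C P a : C P a a.
Proof. by case: (weak_preorder (C P)) => + _; apply. Qed.

Lemma outcome_trans C P a b c : C P a b -> C P b c -> C P a c.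
Proof. by case: (weak_preorder (C P)) => _; apply. Qed.

(** * Transfer of outcomes between pairs *)

Section UnanimityIIA.
Variable C : voting_system A I.
Hypotheses (CU : unanimity C) (CI : IIA C).

(** Packs neutrality, monotonicity and independence into one relation between pairs: [Q] is at least
    as favourable to [c] over [d] as [P] is to [a] over [b]. *)
Definition transfers (a b c d : A) : Prop := forall P Q,
  (forall i, P i a b -> Q i c d) -> (forall i, Q i d c -> P i b a) ->
  C P a b -> C Q c d.

Lemma outcome_IIA P Q a b :
  (forall i, P i a b = Q i a b) -> (forall i, P i b a = Q i b a) ->
  C P a b -> C Q a b.
Proof. by move=> h1 h2; apply: (CI _ _).1 => i; rewrite ?h1 ?h2. Qed.

(** An intermediate profile copies the pattern of [P] on [(a, b)] to [(c, d)]; only distinct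
    alternatives can carry an arbitrary pattern. *)
Lemma transfers_trans a b c d e f :
  c <> d -> transfers a b c d -> transfers c d e f -> transfers a b e f.
Proof.
move=> ncd t1 t2 P Q h1 h2 hC.
have [R hR] := two_point_profile (fun i => P i a b) (fun i => P i b a) ncd.
apply: (t2 R) => [i|i|]; rewrite ?(hR i).1 ?(hR i).2; [exact: h1|exact: h2|].
by apply: (t1 P) => // i; rewrite ?(hR i).1 ?(hR i).2.
Qed.

Lemma transfers_right a b c : a <> b -> a <> c -> b <> c -> transfers a b a c.
Proof.
move=> nab nac nbc P Q h1 h2 hC.
(* [R] agrees with [P] on [(a, b)] and with [Q] on [(a, c)], and all voters put [b] weakly above
   [c]. The last pattern is the largest that transitivity allows for [c] above [b]. *)
have [|R hR] := @three_point_profile A I a b c nab nac nbc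
  (fun i => P i a b) (fun i => P i b a) (fun i => Q i a c) (fun i => Q i c a)
  (fun=> True) (fun i => (P i b a -> Q i c a) /\ (Q i a c -> P i a b)).
  by move=> i; have := h1 i; have := h2 i; tauto.
apply: (@outcome_IIA R).
- by move=> i; rewrite (hR i).2.1.1.
- by move=> i; rewrite (hR i).2.1.2.
apply: (@outcome_trans _ _ _ b); last by apply: CU => i _; rewrite (hR i).2.2.1.
by apply: outcome_IIA hC => i; rewrite ?(hR i).1.1 ?(hR i).1.2.
Qed.

Lemma transfers_left a b c : a <> b -> a <> c -> b <> c -> transfers a b c b.
Proof.
move=> nab nac nbc P Q h1 h2 hC.
(* The mirror image: all voters put [c] weakly above [a]. *)
have [|R hR] := @three_point_profile A I a b c nab nac nbc
  (fun i => P i a b) (fun i => P i b a)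
  (fun i => (P i b a -> Q i b c) /\ (Q i c b -> P i a b)) (fun=> True)
  (fun i => Q i b c) (fun i => Q i c b).
  by move=> i; have := h1 i; have := h2 i; tauto.
apply: (@outcome_IIA R).
- by move=> i; rewrite (hR i).2.2.2.
- by move=> i; rewrite (hR i).2.2.1.
apply: (@outcome_trans _ _ _ a); first by apply: CU => i _; rewrite (hR i).2.1.2.
by apply: outcome_IIA hC => i; rewrite ?(hR i).1.1 ?(hR i).1.2.
Qed.

(** Moving to [(a, c)] and back yields monotonicity on a fixed pair. *)
Lemma transfers_same a b : a <> b -> transfers a b a b.
Proof.
move=> nab; have [c [nac nbc]] := third_alternative a b.
by apply: (@transfers_trans a b a c) => //; apply: transfers_right => // /esym.
Qed.

Lemma transfers_swap a b : a <> b -> transfers a b b a.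
Proof.
move=> nab; have [c [nac nbc]] := third_alternative a b.
apply: (@transfers_trans a b a c) => //; first exact: transfers_right.
apply: (@transfers_trans a c b c) => //; first by apply: transfers_left => // /esym.
by apply: transfers_right => // /esym.
Qed.

Lemma transfers_distinct a b c d : a <> b -> c <> d -> transfers a b c d.
Proof.
move=> nab ncd; have [da|nda] := pselect (d = a).
  subst d; have [->|ncb] := pselect (c = b); first exact: transfers_swap.
  apply: (@transfers_trans a b c b) => //.
    by apply: transfers_left => // /esym.
  by apply: transfers_right => // /esym.
have nad : a <> d by move/esym.
apply: (@transfers_trans a b a d) => //.
  have [->|ndb] := pselect (d = b); first exact: transfers_same.
  by apply: transfers_right => // /esym.
have [->|nca] := pselect (c = a); first exact: transfers_same.
by apply: transfers_left => // /esym.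
Qed.

Lemma transfers_all a b c d : transfers a b c d.
Proof.
have [->|ncd] := pselect (c = d); first by move=> *; apply: outcome_refl.
have [-> P Q h _ _|nab] := pselect (a = b); last exact: transfers_distinct.
by apply: CU => i _; apply: h; case: (weak_preorder (P i)).
Qed.

(** * Decisive sets of a given system *)

Lemma decisive_of_outcome P a b N J : J \subset ~: N ->
  (forall i, P i a b -> i \in N :|: J) -> (forall i, i \notin J -> P i b a) ->
  C P a b -> decisive C N J.
Proof.
move=> JN hN hJ hC; split=> // Q c d ind str.
(* Indifference on [N] and strict preference on [J] make [Q] at least as favourable to [c] over [d]
   as [P] is to [a] over [b]. *)
apply: transfers_all hC => i.
  by move/hN; rewrite inE => /orP[/ind[]|/str[]].
by move=> qdc; apply: hJ; apply/negP => /str[].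
Qed.

Lemma decisive_setC N : decisive C N (~: N).
Proof.
split=> // P a b ind str; apply: CU => i _.
by have [/ind[]//|iN] := boolP (i \in N); case: (str i); rewrite // inE.
Qed.

Lemma outcome_of_decisive N J P a b : decisive C N J ->
  (forall i, P i a b = (i \in N :|: J)) -> (forall i, P i b a = (i \notin J)) ->
  C P a b.
Proof.
move=> [/subsetP JN dJ] hab hba; apply: dJ => i; rewrite /indiff /strict hab hba inE.
  by move=> iN; rewrite iN; split=> //; apply/negP => /JN; rewrite inE iN.
by move=> ->; rewrite orbT.
Qed.

Lemma decisiveI N J K : decisive C N J -> decisive C N K -> decisive C N (J :&: K).
Proof.
move=> dJ dK; have [JN _] := dJ; have [KN _] := dK.
have [a [b [c [nab [nac nbc]]]]] := hA.
(* The pairs [(a, b)], [(b, c)] and [(a, c)] carry the worst patterns for [J], [K] and [J :&: K]. *)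
have [i|P hP] := @three_point_profile A I a b c nab nac nbc
  (fun i => i \in N :|: J) (fun i => i \notin J)
  (fun i => i \in N :|: (J :&: K)) (fun i => i \notin J :&: K)
  (fun i => i \in N :|: K) (fun i => i \notin K).
  move: (subsetP JN i) (subsetP KN i); rewrite !inE.
  by case: (i \in N) (i \in J) (i \in K) => [] [] [] /=;
    do ?[move/(_ isT)] => //; intuition.
apply: (@decisive_of_outcome P a c).
- by apply: subset_trans JN; apply: subsetIl.
- by move=> i; rewrite (hP i).2.1.1.
- by move=> i; rewrite (hP i).2.1.2.
by apply: (@outcome_trans _ _ _ b);
  [apply: (outcome_of_decisive dJ) | apply: (outcome_of_decisive dK)] => i;
  rewrite ?(hP i).1.1 ?(hP i).1.2 ?(hP i).2.2.1 ?(hP i).2.2.2.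
Qed.

(** The decisive factor [~: N] starts the induction: with it, even the empty intersection [setT]
    gives a decisive set. *)
Definition least_decisive N : {set I} :=
  ~: N :&: \bigcap_(K : {set I} | `[< decisive C N K >]) K.

Lemma least_decisiveP N : minimal_decisive C N (least_decisive N).
Proof.
split; last by move=> K /asboolP dK; apply/subIset/orP; right; apply: bigcap_inf.
apply: (big_rec (fun K => decisive C N (~: N :&: K))) => [|K X /asboolP dK dX].
  by rewrite setIT; apply: decisive_setC.
by rewrite setICA; apply: decisiveI.
Qed.

(* Voters comparing neither way are turned into opponents: chain the pattern of
   P on (a, b) and again on (b, c); such a voter may still prefer c to a. *)
Lemma decisive_of_profile P a b : a <> b -> C P a b ->
  decisive C [set i | `[< indiff (P i) a b >]] [set i | `[< strict (P i) a b >]].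
Proof.
move=> nab hC; have [c [nac nbc]] := third_alternative a b.
have [i|Q hQ] := @three_point_profile A I a b c nab nac nbc
  (fun i => P i a b) (fun i => P i b a)
  (fun i => P i a b) (fun i => P i a b -> P i b a)
  (fun i => P i a b) (fun i => P i b a); first by tauto.
apply: (@decisive_of_outcome Q a c).
- apply/subsetP => i; rewrite !inE => /asboolP[_ nba].
  by apply/asboolP => -[_ /nba].
- move=> i; rewrite (hQ i).2.1.1 !inE => pab; apply/orP.
  by have [pba|npba] := pselect (P i b a); [left|right]; apply/asboolP.
- move=> i; rewrite (hQ i).2.1.2 inE => /asboolP nstr pab.
  by apply: contrapT => npba; apply: nstr.
apply: (@outcome_trans _ _ _ b); apply: transfers_all hC => i;
  by rewrite ?(hQ i).1.1 ?(hQ i).1.2 ?(hQ i).2.2.1 ?(hQ i).2.2.2.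
Qed.

(** * Properties of the map [Delta] *)

Variable delta : {set I} -> {set I}.
Hypothesis deltaP : forall N, minimal_decisive C N (delta N).
Let Delta N := delta N :|: N.

Lemma minimal_decisive_disjoint N J i :
  minimal_decisive C N J -> i \in J -> i \notin N.
Proof. by case=> -[/subsetP JN _] _ /JN; rewrite inE. Qed.

Lemma Delta_monotone : map_monotone Delta.
Proof.
split=> [N|M N MN]; first exact: subsetUr.
have [[/subsetP dN hN] _] := deltaP N.
(* Passing from [N] to [M] only turns indifferent voters of [N :\: M] into strict supporters. *)
suff /(deltaP M).2 /subsetP sub : decisive C M (Delta N :\: M).
  apply/subsetP => i; rewrite inE => /orP[/sub|/(subsetP MN) iN].
    by rewrite inE => /andP[].
  by rewrite inE iN orbT.
have [a [b [c [nab [nac nbc]]]]] := hA.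
have [P hP] := two_point_profile
  (fun i => i \in N :|: delta N) (fun i => i \notin delta N) nab.
apply: (@decisive_of_outcome P a b).
- by rewrite setDE; apply: subsetIr.
- by move=> i; rewrite (hP i).1 !inE => /orP[] ->; rewrite ?orbT //; case: (i \in M).
- move=> i; rewrite (hP i).2 !inE negb_and negb_or negbK.
  move=> /orP[/(subsetP MN) iN|/andP[]//].
  by apply/negP => /dN; rewrite inE iN.
apply: (outcome_of_decisive (deltaP N).1) => i; rewrite ?(hP i).1 ?(hP i).2 //.
Qed.

Lemma Delta_minimality : map_minimality Delta.
Proof.
move=> N M disj; apply/eqP; rewrite eqEsubset; apply/andP; split; last first.
  rewrite subUset (Delta_monotone.2 N (N :|: M)) ?subsetUl //=.
  by apply: subset_trans (Delta_monotone.1 _); apply: subsetUr.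
have [[dN hN] _] := deltaP N.
(* Being disjoint from [M], [delta N] stays decisive when indifference is also required on [M]. *)
suff /(deltaP _).2 sub : decisive C (N :|: M) (delta N).
  rewrite /Delta subUset -setUA subsetUr andbT.
  exact: subset_trans sub (subsetUl _ _).
split=> [|P a b ind str].
  rewrite setCU subsetI dN /=; apply/subsetP => i id; rewrite inE.
  by apply/negP => iM; move/setP/(_ i): disj; rewrite !inE id iM.
by apply: hN => // i iN; apply: ind; rewrite inE iN.
Qed.

Lemma Delta_decisive : map_decisive C Delta.
Proof.
have deltaE N : Delta N :\: N = delta N.
  apply/setP => i; rewrite !inE; have := @minimal_decisive_disjoint N _ i (deltaP N).
  by case: (i \in N) (i \in delta N) => [] [] //= /(_ isT).
move=> P a b; split=> [hC|[N [ind]]]; last by rewrite deltaE; apply: (deltaP N).1.2.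
have [eab|nab] := pselect (a = b).
  exists [set: I]; split=> i; last by rewrite !inE.
  by rewrite eab; split; case: (weak_preorder (P i)).
(* With all indifferent voters as witness, the strict supporters form a decisive set, which
   therefore contains the least one. *)
exists [set i | `[< indiff (P i) a b >]]; split=> i; first by rewrite inE => /asboolP.
rewrite deltaE => /(subsetP ((deltaP _).2 _ (decisive_of_profile nab hC))).
by rewrite inE => /asboolP.
Qed.

End UnanimityIIA.

(** * The voting system defined by a monotone map *)

Section Converse.
Variable D : {set I} -> {set I}.
Hypothesis DM : map_monotone D.

Definition rule P (a b : A) : Prop :=
  exists N, indiff_on P N a b /\ strict_on P (D N :\: N) a b.

Lemma rule_unanimous P a b : weak_on P [set: I] a b -> rule P a b.
Proof.
move=> w; exists [set i | `[< indiff (P i) a b >]].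
split=> i; first by rewrite inE => /asboolP.
rewrite !inE => /andP[/asboolP nind _]; split; first exact: w.
by move=> pba; apply: nind; split; first exact: w.
Qed.

Lemma rule_monotone P Q a b : (forall i, P i a b -> Q i a b) ->
  (forall i, Q i b a -> P i b a) -> rule P a b -> rule Q a b.
Proof.
(* The witness keeps the voters of [N] still indifferent in [Q]; the others in [N] have become
   strict supporters. *)
move=> h1 h2 [N [ind str]]; exists [set i in N | `[< Q i b a >]].
split=> i; first by rewrite inE => /andP[/ind[/h1 ? _] /asboolP].
rewrite !inE negb_and => /andP[iNQ iD].
have /(subsetP (DM.2 _ N _)) iDN : i \in D [set i in N | `[< Q i b a >]] by [].
have [iN|iN] := boolP (i \in N).
  by move: iNQ; rewrite iN => /asboolP nq; split=> //; apply/h1; case: (ind i iN).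
have [|pab npba] := str i.
  by rewrite inE iN iDN //; apply/subsetP => j; rewrite inE => /andP[].
by split; [apply: h1 | move/h2].
Qed.

Lemma rule_preorder P : PreOrder (rule P).
Proof.
split=> [a|a b c [N [indN strN]] [M [indM strM]]].
  by apply: rule_unanimous => i _; case: (weak_preorder (P i)).
exists (N :&: M); split=> i.
  rewrite inE => /andP[/indN[ab ba] /indM[bc cb]].
  by case: (weak_preorder (P i)) => _ tr; split; apply: (tr _ b).
rewrite !inE negb_and => /andP[iNM iD].
have iDN := subsetP (DM.2 _ _ (subsetIl N M)) _ iD.
have iDM := subsetP (DM.2 _ _ (subsetIr N M)) _ iD.
(* The voter supports both steps weakly, and strictly the step whose witness omits [i]. *)
have hN : P i a b /\ (i \notin N -> ~ P i b a).
  have [/indN[]//|iN] := boolP (i \in N).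
  by have [|? ?] := strN i; rewrite ?inE ?iN.
have hM : P i b c /\ (i \notin M -> ~ P i c b).
  have [/indM[]//|iM] := boolP (i \in M).
  by have [|? ?] := strM i; rewrite ?inE ?iM.
case: (weak_preorder (P i)) => _ tr; split; first exact: (tr _ b _ hN.1 hM.1).
move=> ca; case/orP: iNM => [/hN.2|/hM.2]; apply.
  exact: (tr _ c _ hM.1 ca).
exact: (tr _ a _ ca hN.1).
Qed.

Definition rule_system : voting_system A I := fun P => MkPPO (rule_preorder P).

Lemma rule_system_unique C : map_decisive C D -> rule_system = C.
Proof.
by move=> h; apply/funext => P; apply: PPO_ext => a b; rewrite (h P a b).
Qed.

Lemma rule_minimal_decisive N : map_minimality D ->
  minimal_decisive rule_system N (D N :\: N).
Proof.
move=> DI; split.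
  by split=> [|P a b ind str]; [rewrite setDE subsetIr | exists N].
move=> K [/subsetP KN hK]; have [a [b [c [nab _]]]] := hA.
(* The worst pattern for [K]; its witness [M] will satisfy [M \subset N] and
   [D M :\: M \subset K]. *)
have [P hP] := two_point_profile
  (fun i => i \in N :|: K) (fun i => i \notin K) nab.
have [|i iK|M [ind str]] := hK P a b.
- move=> i iN; rewrite /indiff (hP i).1 (hP i).2 inE iN; split=> //.
  by apply/negP => /KN; rewrite inE iN.
- by rewrite /strict (hP i).1 (hP i).2 inE iK orbT.
have MN : M \subset N.
  apply/subsetP => i /ind[]; rewrite (hP i).1 (hP i).2 inE.
  by case: (i \in N) => //= ->.
have DK i : i \in D M -> i \notin M -> i \in K.
  move=> iD iM; have [|_] := str i; first by rewrite inE iM.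
  by rewrite (hP i).2 => /negP; rewrite negbK.
(* Minimality then gives [D N = D M :|: (N :\: M)], hence [D N :\: N \subset D M :\: M]. *)
have /DI : D M :&: (N :\: M) = set0.
  apply/setP => i; rewrite !inE; apply/negP => /and3P[iD iM iN].
  by have := KN _ (DK _ iD iM); rewrite inE iN.
have -> : M :|: N :\: M = N by rewrite -[in X in X :|: _](setIidPr MN) setID.
move=> ->; apply/subsetP => i; rewrite !inE => /andP[iN /orP[iD|]].
  by apply: DK => //; apply: contra iN; apply: (subsetP MN).
by rewrite (negbTE iN) andbF.
Qed.

End Converse.
End Outcome.

Theorem theorem1p2 (A : Type) (I : finType)
    (hA : exists a b c : A, a <> b /\ a <> c /\ b <> c) :
  (forall C : voting_system A I, unanimity C -> IIA C ->
     exists delta : {set I} -> {set I},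
       (forall N : {set I}, minimal_decisive C N (delta N)) /\
       unique
         (fun D : {set I} -> {set I} =>
            map_monotone D /\ map_minimality D /\ map_decisive C D)
         (fun N : {set I} => delta N :|: N))
  /\
  (forall D : {set I} -> {set I}, map_monotone D ->
     (exists! C : voting_system A I, map_decisive C D) /\
     (forall C : voting_system A I, map_decisive C D ->
        unanimity C /\ neutrality C /\ vs_monotone C /\ IIA C /\
        (map_minimality D ->
         forall N : {set I}, minimal_decisive C N (D N :\: N)))).
Proof.
split=> [C CU CI|D DM].
  exists (least_decisive C); have dP := least_decisiveP hA CU CI.
  split=> //; split.
    split; first exact: (Delta_monotone hA CU CI dP).
    split; first exact: (Delta_minimality hA CU CI dP).
    exact: (Delta_decisive hA CU CI dP).
  move=> D [DM [DI DC]]; apply/funext => N.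
  (* Any competing [D] defines [C] by its rule, so [D N :\: N] is also a least decisive set. *)
  have [dD minD] := rule_minimal_decisive hA DM N DI.
  rewrite (rule_system_unique DM DC) in dD minD.
  have eD : least_decisive C N = D N :\: N.
    by apply/eqP; rewrite eqEsubset (dP N).2 //; apply: minD; case: (dP N).
  by rewrite eD setUC -[X in X :|: _](setIidPr (DM.1 N)) setID.
split.
  by exists (rule_system DM); split=> [P a b //|C]; exact: rule_system_unique.
move=> C CD; rewrite -(rule_system_unique DM CD).
have mono : vs_monotone (rule_system DM) by move=> P Q a b; exact: rule_monotone.
split; first by move=> P a b; exact: rule_unanimous.
split; first by move=> rho _ P; apply: PPO_ext.
split=> //; split; last by move=> DI N; exact: rule_minimal_decisive.
by move=> P Q a b h1 h2; split; apply: mono => i; rewrite ?(h1 i) ?(h2 i).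
Qed.
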